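(* Let $(T,d)$ be a complete metric tree, embedded into $\ell_\infty(T)$ by the canonical embedding $h:T\to\ell_\infty(T)$, $h(x)(y)=d(x,y)-d(x^*,y)$, where $x^*\in T$ is a fixed point. Let $x_1,\dots,x_n\in T$, let $\alpha_1,\dots,\alpha_n>0$ with $\sum_{k=1}^n\alpha_k=1$, and let $\tilde x^{(\alpha)}=\sum_{k=1}^n\alpha_k h(x_k)\in\ell_\infty(T)$. For $x_0\in T$, the following are equivalent: (1) $x_0\in\mathbf{P}(\tilde x^{(\alpha)})$. (2) $d(x_0,x)\le\sum_{k=1}^n\alpha_k d(x_k,x)$ for every $x\in T$.
   Context: A metric segment $[x,y]$ in a metric space is the image of an isometric embedding $\gamma:[a,b]\to M$ of a real interval with $\gamma(a)=x$, $\gamma(b)=y$. A metric space $T$ is a metric tree if for all $x,y,z\in T$: (1) there is a unique metric segment $[x,y]$ from $x$ to $y$, and (2) $[x,z]\cap[z,y]=\{z\}$ implies $[x,z]\cup[z,y]=[x,y]$. For an isometric embedding $U$ of $T$ into a normed space $X$ (points of $T$ being identified with their images) and $\tilde x\in X$, $\mathbf{P}(\tilde x)$ denotes the set of all points $x_0\in T$ for which there is a contractive (i.e. $1$-Lipschitz) retraction $\pi$ from $X$ onto $U(T)$ with $\pi(\tilde x)=U(x_0)$. $\ell_\infty(T)$ is the space of bounded real functions on $T$ with the supremum norm. *)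

(* Defs.v *)
From HB Require Import structures.
From mathcomp Require Import all_boot all_order all_algebra.
From mathcomp Require Import all_classical all_reals all_analysis.

Set Implicit Arguments.
Unset Strict Implicit.
Unset Printing Implicit Defensive.

Import Order.TTheory GRing.Theory Num.Theory.
Import numFieldNormedType.Exports.

Local Open Scope classical_set_scope.
Local Open Scope ring_scope.

(* [completeType] is a class of pointed spaces, hence so is this join. *)
#[short(type="completeMetricType")]
HB.structure Definition CompleteMetric (K : numDomainType) :=
  {M of Metric K M & Complete M}.

Section MetricTree.
Context {R : realType} {M : metricType R}.

Definition is_metric_segment (x y : M) (S : set M) : Prop :=
  exists (a b : R) (gamma : R -> M),
    [/\ a <= b,
        {in `[a, b] &, forall s t, mdist (gamma s) (gamma t) = `|s - t|},
        gamma a = x,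
        gamma b = y
      & S = gamma @` `[a, b]].

End MetricTree.

Definition metric_tree {R : realType} (T : metricType R) : Prop :=
  (forall x y : T, exists! S, is_metric_segment x y S) /\
  (forall (x y z : T) (Sxz Szy Sxy : set T),
    is_metric_segment x z Sxz ->
    is_metric_segment z y Szy ->
    is_metric_segment x y Sxy ->
    Sxz `&` Szy = [set z] -> Sxz `|` Szy = Sxy).

Section ContractiveRetraction.
Context {R : realType} {X : normedModType R}.

Definition contractive_retraction (A : set X) (pi : X -> X) : Prop :=
  [/\ range pi = A,
      {in A, forall a, pi a = a}
    & 1.-lipschitz_[set: X] pi].

(* The set P(xt) for the copy U(T) of T in X; meant for isometric U. *)
Definition projections {T : Type} (U : T -> X) (xt : X) : set T :=
  [set x0 | exists2 pi, contractive_retraction (range U) pi & pi xt = U x0].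

End ContractiveRetraction.

Section Linf.
Context (R : realType) (T : Type).

Definition linf_pred : {pred T -> R} := mem (bounded_fun : set (T -> R)).

Record linf := Linf { linf_val :> T -> R ; _ : linf_val \in linf_pred }.

HB.instance Definition _ := [isSub for linf_val].
HB.instance Definition _ := [Choice of linf by <:].

Lemma linf_predP (f : T -> R) :
  reflect (exists C, forall y, `|f y| <= C) (f \in linf_pred).
Proof.
apply: (iffP idP) => [|[C fC]].
  by rewrite inE => /pinfty_ex_gt0[C _ fC]; exists C => y; exact: fC.
rewrite inE; exists C; split; first exact: num_real.
by move=> D /ltW CD y _; exact: le_trans CD.
Qed.

Lemma linf_submod_closed : submod_closed linf_pred.
Proof.
split; first by apply/linf_predP; exists 0 => y; rewrite normr0.
move=> a f g /linf_predP[C fC] /linf_predP[D gD].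
apply/linf_predP; exists (`|a| * C + D) => y /=.
rewrite (le_trans (ler_normD _ _))// lerD// normrM.
by rewrite ler_wpM2l.
Qed.

HB.instance Definition _ :=
  GRing.isSubmodClosed.Build R (T -> R) linf_pred linf_submod_closed.
HB.instance Definition _ := [SubChoice_isSubLmodule of linf by <:].

Definition linf_norm (f : linf) : R := sup (range (fun y => `|f y|)).

Lemma linf_norm_ub (f : linf) y : `|f y| <= linf_norm f.
Proof.
have /linf_predP[C fC] := valP f.
apply: ub_le_sup; last by exists y.
by exists C => _ [z _ <-]; exact: fC.
Qed.

Lemma linf_norm_le (f : linf) C :
  0 <= C -> (forall y, `|f y| <= C) -> linf_norm f <= C.
Proof.
move=> C0 fC; rewrite /linf_norm.
have [->|/set0P ne] := eqVneq (range (fun y => `|f y|)) set0.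
  by rewrite sup0.
by apply: ge_sup => // _ [z _ <-]; exact: fC.
Qed.

Lemma linf_norm_ge0 (f : linf) : 0 <= linf_norm f.
Proof.
have [ne|/set0P[_ [y _ _]]] := eqVneq (range (fun y => `|f y|)) set0.
  by rewrite /linf_norm ne sup0.
exact: le_trans (linf_norm_ub f y).
Qed.

Lemma linf_normD (f g : linf) : linf_norm (f + g) <= linf_norm f + linf_norm g.
Proof.
apply: linf_norm_le => [|y]; first by rewrite addr_ge0// linf_norm_ge0.
by rewrite (le_trans (ler_normD _ _))// lerD// linf_norm_ub.
Qed.

Lemma linf_normZ (a : R) (f : linf) : linf_norm (a *: f) = `|a| * linf_norm f.
Proof.
have le b (g : linf) : linf_norm (b *: g) <= `|b| * linf_norm g.
  apply: linf_norm_le => [|y]; first by rewrite mulr_ge0// linf_norm_ge0.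
  by rewrite [leLHS]normrM ler_wpM2l// linf_norm_ub.
apply/eqP; rewrite eq_le le/=; have [->|a0] := eqVneq a 0.
  by rewrite normr0 mul0r linf_norm_ge0.
rewrite -ler_pdivlMl ?normr_gt0// -normfV.
by apply: le_trans (le _ _); rewrite scalerA mulVf// scale1r.
Qed.

Lemma linf_norm0_eq0 (f : linf) : linf_norm f = 0 -> f = 0.
Proof.
move=> f0; apply/val_inj/funext => y; apply/eqP.
by rewrite -normr_le0 -f0 linf_norm_ub.
Qed.

HB.instance Definition _ :=
  Lmodule_isNormed.Build R linf linf_normD linf_normZ linf_norm0_eq0.

End Linf.

Section CanonicalEmbedding.
Context {R : realType} {T : metricType R}.

Lemma canonical_embedding_subproof (xs x : T) :
  (fun y => mdist x y - mdist xs y) \in @linf_pred R T.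
Proof.
apply/linf_predP; exists (mdist x xs) => y.
rewrite ler_norml lerBrDr lerBlDr metric_triangle andbT addrC.
by rewrite lerBlDr (metric_sym x xs) addrC metric_triangle.
Qed.

Definition canonical_embedding (xs x : T) : linf R T :=
  Linf (canonical_embedding_subproof xs x).

Lemma canonical_embedding_isometry (xs x y : T) :
  `|canonical_embedding xs x - canonical_embedding xs y| = mdist x y.
Proof.
have E z : (canonical_embedding xs x - canonical_embedding xs y) z
    = mdist x z - mdist y z.
  by rewrite /= /GRing.add/= opprB addrA subrK.
apply/eqP; rewrite eq_le; apply/andP; split.
  apply: linf_norm_le => [|z]; first exact: mdist_ge0.
  rewrite E ler_norml lerBrDr lerBlDr metric_triangle andbT addrC.
  by rewrite lerBlDr (metric_sym x y) addrC metric_triangle.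
apply: le_trans (linf_norm_ub _ y).
by rewrite E mdistxx subr0 ler_norm.
Qed.

End CanonicalEmbedding.

(* Main.v *)
(* If x0 = pi(xt), then d(x0, y) = |pi(xt) - pi(h y)| <= |xt - h y|, and
   |xt - h y| = sum_k alpha_k d(x_k, y), the supremum being attained at y.

   Conversely, a contractive retraction is obtained explicitly: f is sent to the
   point nearest to w of the intersection of all balls B(y, |f - h y|).  Seen
   from the root w, the nearest points of these pairwise intersecting balls form
   a chain in the tree order, so they converge, by completeness, to the required
   point; the four-point condition shows that it depends on f in a 1-Lipschitz
   way.  When w = x0, inequality (2) says that w itself lies in all the balls
   attached to xt, which is therefore sent to x0. *)
Require Import Defs.
From HB Require Import structures.
From mathcomp Require Import all_boot all_order all_algebra.
From mathcomp Require Import all_classical all_reals all_analysis.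
From mathcomp Require Import lra.

Set Implicit Arguments.
Unset Strict Implicit.
Unset Printing Implicit Defensive.

Import Order.TTheory GRing.Theory Num.Theory.
Import numFieldNormedType.Exports.

Local Open Scope classical_set_scope.
Local Open Scope ring_scope.

(** * Segments, the four-point condition and nearest points of balls in a metric tree *)

Section MetricTreeGeometry.
Context {R : realType} {T : metricType R}.
Implicit Types (w x y z p q m : T) (S : set T).

Lemma ler_mdist_sub x y z : mdist x z - mdist y z <= mdist x y.
Proof. by rewrite lerBlDr metric_triangle. Qed.

Lemma metric_segment_left x y S : is_metric_segment x y S -> S x.
Proof.
move=> [a [b [gamma [ab _ <- _ ->]]]].
by exists a => //=; rewrite in_itv/= lexx.
Qed.

Lemma metric_segment_right x y S : is_metric_segment x y S -> S y.
Proof.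
move=> [a [b [gamma [ab _ _ <- ->]]]].
by exists b => //=; rewrite in_itv/= lexx andbT.
Qed.

Lemma metric_subsegment (a b s t : R) (gamma : R -> T) :
    {in `[a, b] &, forall s t, mdist (gamma s) (gamma t) = `|s - t|} ->
    a <= s -> s <= t -> t <= b ->
  is_metric_segment (gamma s) (gamma t) (gamma @` `[s, t]).
Proof.
move=> gammaE as_ st tb; exists s, t, gamma; split=> // u v.
rewrite !in_itv/= => /andP[su ut] /andP[sv vt].
by apply: gammaE; rewrite in_itv/=; apply/andP; split; lra.
Qed.

Lemma metric_segment_mdistD x y S m :
  is_metric_segment x y S -> S m -> mdist x m + mdist m y = mdist x y.
Proof.
move=> [a [b [gamma [ab gammaE <- <- ->]]]] [t]/=.
rewrite in_itv/= => /andP[at_ tb] <-.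
rewrite !gammaE ?in_itv/= ?lexx ?ab ?at_ ?tb//.
by rewrite ler0_norm ?ler0_norm ?ler0_norm; lra.
Qed.

Lemma metric_segment_mdist x y S m n : is_metric_segment x y S -> S m -> S n ->
  mdist m n = `|mdist x m - mdist x n|.
Proof.
move=> [a [b [gamma [ab gammaE <- _ ->]]]] [s /= sab <-] [t /= tab <-].
have aab : a \in `[a, b] by rewrite in_itv/= lexx.
rewrite !gammaE//; move: sab tab; rewrite !in_itv/= => /andP[? ?] /andP[? ?].
have -> : `|a - s| = s - a by rewrite ler0_norm; lra.
have -> : `|a - t| = t - a by rewrite ler0_norm; lra.
by congr (`| _ |); lra.
Qed.

Hypothesis hT : metric_tree T.

Lemma metric_tree_segment x y : exists S, is_metric_segment x y S.
Proof. by have [S [xyS _]] := hT.1 x y; exists S. Qed.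

Lemma metric_tree_point x y (t : R) : 0 <= t -> t <= mdist x y ->
  exists2 m, mdist x m = t & mdist x m + mdist m y = mdist x y.
Proof.
move=> t0 txy; have [S xyS] := metric_tree_segment x y.
case: (xyS) => a [b [gamma [ab gammaE xE yE SE]]].
have abE : mdist x y = b - a.
  by rewrite -xE -yE gammaE ?in_itv/= ?lexx ?ab// ler0_norm; lra.
have atb : a + t \in `[a, b] by rewrite in_itv/=; apply/andP; split; lra.
exists (gamma (a + t)).
  by rewrite -xE gammaE ?in_itv/= ?lexx ?ab// ler0_norm; lra.
by apply: (metric_segment_mdistD xyS); rewrite SE; exists (a + t).
Qed.

(** The second axiom of a metric tree puts [z] on [x, y], where distances add up. *)
Lemma metric_tree_mdistD x y z (Sxz Szy : set T) :
    is_metric_segment x z Sxz -> is_metric_segment z y Szy ->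
    Sxz `&` Szy = [set z] ->
  mdist x z + mdist z y = mdist x y.
Proof.
move=> xzS zyS SI; have [S xyS] := metric_tree_segment x y.
apply: (metric_segment_mdistD xyS).
rewrite -(hT.2 _ _ _ _ _ _ xzS zyS xyS SI).
by left; exact: metric_segment_right xzS.
Qed.

(* [m] is a point of [S] at minimal distance from [z]: this forces [m] to be the
   only common point of [z, m] and of either half of [S]. *)
Lemma metric_tree_projection x y S z : is_metric_segment x y S ->
  exists2 m, S m & mdist x m + mdist m z = mdist x z /\
                   mdist z m + mdist m y = mdist z y.
Proof.
move=> xyS; case: (xyS) => a [b [gamma [ab gammaE xE yE SE]]].
have gamma_cont : {within `[a, b], continuous (fun t => mdist z (gamma t))}.
  apply/subspace_continuousP => s sab; apply/cvgrPdist_lt => e e0.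
  rewrite near_withinE; near=> t => tab.
  have : mdist (gamma s) (gamma t) < e.
    by rewrite gammaE//; near: t; exact: (@cvgr_dist_lt _ _ _ (nbhs s) _ id s).
  have := ler_mdist_sub (gamma s) (gamma t) z.
  have := ler_mdist_sub (gamma t) (gamma s) z.
  rewrite !(metric_sym _ z) (metric_sym (gamma t)) => ? ? ?.
  by rewrite ltr_norml /from_subspace; apply/andP; split; lra.
have [s sab smin] := EVT_min ab gamma_cont.
have /andP[as_ sb] : a <= s <= b by rewrite in_itv in sab.
pose m := gamma s.
(* For a common point [u], minimality gives d(z, m) <= d(z, u) = d(z, m) - d(u, m), hence
   [u = m]. *)
have segI (U V : set T) : U m ->
    (forall u, U u -> mdist z u + mdist u m = mdist z m) ->
    V m -> V `<=` S -> U `&` V = [set m].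
  move=> Um Uz Vm VS; apply/seteqP; split=> [u [Uu /VS]|_ ->//].
  rewrite SE => -[t /= tab uE]; have := smin t tab; rewrite uE.
  have := Uz u Uu; have := mdist_ge0 u m => ? ? ?.
  by apply: mdist_positivity; lra.
have subS (c d : R) : a <= c -> d <= b -> gamma @` `[c, d] `<=` S.
  move=> ac db _ [t /= tcd <-]; rewrite SE; exists t => //=.
  by move: tcd; rewrite !in_itv/= => /andP[? ?]; apply/andP; split; lra.
have [U zmU] := metric_tree_segment z m.
have [V mzV] := metric_tree_segment m z.
have xmS : is_metric_segment x m (gamma @` `[a, s]).
  by rewrite -xE; exact: (metric_subsegment gammaE).
have myS : is_metric_segment m y (gamma @` `[s, b]).
  by rewrite -yE; exact: (metric_subsegment gammaE).
exists m; first by rewrite SE; exists s.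
split.
- apply: (metric_tree_mdistD xmS mzV); rewrite setIC; apply: segI.
  + exact: metric_segment_left mzV.
  + move=> u /(metric_segment_mdistD mzV).
    by rewrite addrC !(metric_sym _ z) (metric_sym m).
  + exact: metric_segment_right xmS.
  + exact: subS.
- apply: (metric_tree_mdistD zmU myS); apply: segI.
  + exact: metric_segment_right zmU.
  + by move=> u /(metric_segment_mdistD zmU).
  + exact: metric_segment_left myS.
  + exact: subS.
Unshelve. all: by end_near. Qed.

(** Project [z] and [w] to [m] and [n] on [x, y] and bound d(z, w) by the path through [m] and [n];
    the order of [m] and [n] on the segment selects the term of the maximum. *)
Lemma metric_tree_four_point x y z w :
  mdist x y + mdist z w <=
    Num.max (mdist x z + mdist y w) (mdist x w + mdist y z).
Proof.
have [S xyS] := metric_tree_segment x y.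
have [m Sm [xzE zyE]] := metric_tree_projection z xyS.
have [n Sn [xwE wyE]] := metric_tree_projection w xyS.
have := metric_segment_mdistD xyS Sm; have := metric_segment_mdistD xyS Sn.
have := metric_segment_mdist xyS Sm Sn.
have := metric_triangle z m w; have := metric_triangle m n w.
rewrite (metric_sym y w) (metric_sym y z) (metric_sym w n) in wyE *.
rewrite (metric_sym m z) in xzE *.
move=> ? ? + ? ?.
by case: ler0P => ? mnE; rewrite le_max; apply/orP; [right|left]; lra.
Qed.

(* [p] and [q] are the points nearest to [w] of the intersecting balls B(x, r)
   and B(y, s); the farther one lies in both balls, and beyond the other. *)
Lemma rooted_top_comparison w x y p q (r s : R) :
    mdist w p = Num.max 0 (mdist w x - r) ->
    mdist w p + mdist p x = mdist w x ->
    mdist w q = Num.max 0 (mdist w y - s) ->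
    mdist w q + mdist q y = mdist w y ->
    mdist x y <= r + s -> mdist w p <= mdist w q ->
  mdist q x <= r /\ mdist p q <= mdist w q - mdist w p.
Proof.
move=> wpE wpx wqE wqy xy_le pq_le.
have p_ge0 := mdist_ge0 w p.
have [wp_ge wq_or] : mdist w x - r <= mdist w p /\
    (mdist w q = 0 \/ mdist w q = mdist w y - s).
  rewrite wpE wqE le_max lexx orbT; split=> //.
  by case: leP => _; [right|left].
have qx_le : mdist q x <= r.
  have := metric_tree_four_point q x w y.
  rewrite le_max !(metric_sym q w) (metric_sym x w) => /orP[] ?; last lra.
  have := metric_triangle q w x; rewrite (metric_sym q w).
  by case: wq_or => ? ?; lra.
split=> //; have := metric_tree_four_point p q w x.
rewrite le_max (metric_sym p w) (metric_sym q w) => /orP[] ?; last lra.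
(* What remains is d(p, q) + d(w, x) <= d(w, p) + d(q, x). If d(w, x) >= r, then d(w, p) = d(w, x) -
   r forces d(p, q) <= 0; otherwise [p] is [w]. *)
case: (leP 0 (mdist w x - r)) wpE => ? wpE; first lra.
have pw : w = p by apply: mdist_positivity.
by rewrite -pw mdistxx; lra.
Qed.

(* [p] is the point of the intersection of the balls B(y, r y) nearest to [w]:
   the second clause bounds d(w, p) by the supremum over y of the distances
   max(0, d(w, y) - r y) from [w] to these balls. *)
Definition nearest_common_point w (r : T -> R) p :=
  (forall y, mdist p y <= r y) /\
  (forall e, 0 < e -> exists y, mdist w p <= Num.max 0 (mdist w y - r y) + e).

(** Let [q] be the point farther from [w], and [y] a center whose ball almost realizes d(w, q); the
    four-point condition for [p], [q], [w], [y] then bounds d(p, q). *)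
Lemma nearest_common_point_lipschitz w (r s : T -> R) p q (e : R) :
    nearest_common_point w r p -> nearest_common_point w s q ->
    (forall y, `|r y - s y| <= e) ->
  mdist p q <= e.
Proof.
wlog pq : r s p q / mdist w p <= mdist w q => [hwlog rp sq rs|].
  have [pq|/ltW qp] := leP (mdist w p) (mdist w q); first exact: (hwlog r s).
  by rewrite metric_sym; apply: (hwlog s r) => // y; rewrite distrC.
move=> [pr _] [qs q_min] rs; apply/ler_addgt0Pr => d d0.
(* If [w] lies in the ball of [y], both [p] and [q] are within [d / 2] of [w], and this error counts
   twice. *)
have d20 : 0 < d / 2 by rewrite divr_gt0.
have [y wq_le] := q_min _ d20.
have := rs y; rewrite ler_norml => /andP[_ rs_le].
have e0 : 0 <= e by exact: le_trans (normr_ge0 _) (rs y).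
have := metric_triangle p w q; rewrite (metric_sym p w).
have := pr y; have := qs y; have := metric_tree_four_point p q w y.
rewrite le_max (metric_sym p w) (metric_sym q w).
by case: (leP 0 (mdist w y - s y)) wq_le => ? ? /orP[] ? ? ? ?; lra.
Qed.

End MetricTreeGeometry.

(** * Existence of nearest common points by completeness, and the retraction *)

Section Retraction.
Context {R : realType} {T : completeMetricType R}.
Hypothesis hT : metric_tree T.
Implicit Types (w x y p q : T).

(** Along the chain of nearest points [top y], distances are differences of the heights [t y] over
    [w]. A sequence with heights tending to [sup (range t)] is thus Cauchy, and its limit is the
    required point. *)
Lemma nearest_common_point_exists w (r : T -> R) :
  (forall x y, mdist x y <= r x + r y) -> exists p, nearest_common_point w r p.
Proof.
move=> rD; pose t y := Num.max 0 (mdist w y - r y).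
have r_ge0 y : 0 <= r y by have := rD y y; rewrite mdistxx; lra.
have /choice[top topP] y : exists p,
    mdist w p = t y /\ mdist w p + mdist p y = mdist w y.
  have [||p ? ?] := metric_tree_point hT (x := w) (y := y) (t := t y).
  - by rewrite /t le_max lexx.
  - by rewrite /t ge_max mdist_ge0 gerBl r_ge0.
  - by exists p.
have top_le x y : t x <= t y ->
    mdist (top y) x <= r x /\ mdist (top x) (top y) <= t y - t x.
  have [<- ?] := topP x; have [<- ?] := topP y => xy.
  by apply: (rooted_top_comparison hT (w := w) (y := y) (s := r y));
    rewrite // (topP _).1.
(* A top lower than [top x] by at most [e] is within [e] of [top x], which lies in the ball of
   [x]. *)
have top_close x y e : 0 <= e -> t x <= t y + e ->
    mdist (top y) x <= r x + e.
  move=> e0 xye; have [/top_le[] *|/ltW yx] := leP (t x) (t y); first lra.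
  have [_ ?] := top_le _ _ yx; have := metric_triangle (top y) (top x) x.
  have [] := topP x; have : mdist w x - r x <= t x by rewrite le_max lexx orbT.
  by move=> *; lra.
have t_sup : has_sup (range t).
  split; first by exists (t w), w.
  (* The ball centered at [w] itself meets all the others, so its radius bounds the heights. *)
  exists (r w) => _ [y _ <-]; rewrite ge_max r_ge0/=.
  by have := rD w y; lra.
have t_le_sup y : t y <= sup (range t).
  by apply: sup_upper_bound => //; exists y.
have /choice[u uP] (n : nat) : exists y, sup (range t) - n.+1%:R^-1 < t y.
  have [|_ [y _ <-] ?] := sup_adherent _ t_sup (eps := n.+1%:R^-1).
    by rewrite invr_gt0.
  by exists y.
have t_close n y e : n.+1%:R^-1 < e -> t y < t (u n) + e.
  move=> ne; rewrite -ltrBlDr (le_lt_trans _ (uP n))//.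
  by rewrite lerB// ltW.
have u_close m n e : m.+1%:R^-1 < e -> n.+1%:R^-1 < e ->
    mdist (top (u m)) (top (u n)) < e.
  move=> /(t_close _ (u n)) ? /(t_close _ (u m)) ?.
  have [/top_le[_]|/ltW/top_le[_]] := leP (t (u m)) (t (u n));
    by rewrite ?(metric_sym (top (u n))); lra.
have : cvg (top \o u @ \oo).
  apply: cauchy_cvg; apply: cauchy_exP => e e0.
  have [N _ NP] := near_infty_natSinv_lt (PosNum e0).
  exists (top (u N)), N => // n /= Nn; rewrite ballEmdist/=.
  by apply: u_close; apply: NP => //=.
move=> /cvg_ex[p u_p].
have p_close e : 0 < e -> exists2 n, n.+1%:R^-1 < e & mdist p (top (u n)) < e.
  move=> e0; near \oo => n; exists n.
    by near: n; exact: (near_infty_natSinv_lt (PosNum e0)).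
  by near: n; exact: (metricType_numDomainType.cvgr_dist_lt u_p).
exists p; split=> [y|e e0]; last first.
  have [n _ pn] := p_close _ e0; exists (u n).
  have := metric_triangle w (top (u n)) p; rewrite (metric_sym (top (u n)) p).
  by rewrite (topP (u n)).1 -/(t _); lra.
apply/ler_addgt0Pr => e e0; have [|n ne pn] := p_close (e / 2); first lra.
have e2_ge0 : 0 <= e / 2 by lra.
have := top_close y (u n) _ e2_ge0 (ltW (t_close _ y _ ne)).
by have := metric_triangle p (top (u n)) y; lra.
Unshelve. all: by end_near. Qed.

(** The radii |f - h y| change by at most |f - g| when [f] becomes [g], and for [f = h x] the ball
    at [x] has radius 0. *)
Lemma canonical_embedding_retraction (xs w : T) : exists p : linf R T -> T,
  [/\ forall x, p (canonical_embedding xs x) = x,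
      forall f g, mdist (p f) (p g) <= `|f - g|
    & forall f, (forall y, mdist w y <= `|f - canonical_embedding xs y|) ->
        p f = w].
Proof.
set h := canonical_embedding xs.
have /choice[p pP] f : exists p, nearest_common_point w (fun y => `|f - h y|) p.
  apply: nearest_common_point_exists => x y.
  rewrite -(canonical_embedding_isometry xs) -/h (distrC f).
  have -> : h x - h y = (h x - f) + (f - h y) by rewrite addrA subrK.
  exact: ler_normD.
exists p; split=> [x|f g|f fw].
- apply: mdist_positivity; apply/eqP; rewrite eq_le mdist_ge0 andbT.
  by apply: le_trans ((pP (h x)).1 x) _; rewrite subrr normr0.
- apply: (nearest_common_point_lipschitz hT (pP f) (pP g)) => y.
  apply: le_trans (ler_dist_dist _ _) _.
  by have -> : f - h y - (g - h y) = f - g by rewrite opprB addrA subrK.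
- apply/esym/mdist_positivity/eqP; rewrite eq_le mdist_ge0 andbT.
  apply/ler_addgt0Pr => e e0; have [y] := (pP f).2 e e0.
  by rewrite (max_idPl _)// subr_le0.
Qed.

End Retraction.

Lemma dist_convex_canonical_embedding (R : realType) (T : metricType R) (xs : T)
    (n : nat) (x : 'I_n -> T) (alpha : 'I_n -> R) (y : T) :
    (forall k, 0 <= alpha k) -> \sum_(k < n) alpha k = 1 ->
  `|\sum_(k < n) alpha k *: canonical_embedding xs (x k) -
    canonical_embedding xs y| = \sum_(k < n) alpha k * mdist (x k) y.
Proof.
move=> alpha_ge0 alpha_sum1.
(* As the weights sum to 1, [h y] can be moved inside the sum. *)
have -> : \sum_(k < n) alpha k *: canonical_embedding xs (x k) -
    canonical_embedding xs y =
    \sum_(k < n) alpha k *: (canonical_embedding xs (x k) -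
      canonical_embedding xs y).
  under [RHS]eq_bigr do rewrite scalerBr.
  by rewrite sumrB -scaler_suml alpha_sum1 scale1r.
apply/eqP; rewrite eq_le; apply/andP; split.
  apply: le_trans (ler_norm_sum _ _ _) _; apply: ler_sum => k _.
  by rewrite normrZ ger0_norm// canonical_embedding_isometry.
have linf_sum (I : Type) (s : seq I) (F : I -> linf R T) z :
    (\sum_(i <- s) F i) z = \sum_(i <- s) F i z.
  by elim/big_ind2: _ => // f a g b <- <-.
(* At the coordinate [y], the base point terms cancel and d(y, y) = 0. *)
apply: le_trans (linf_norm_ub _ y); apply: le_trans (ler_norm _).
rewrite linf_sum; apply: ler_sum => k _ /=.
rewrite [leRHS](_ : _ = alpha k * (mdist (x k) y - mdist xs y -
  (mdist y y - mdist xs y)))//.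
by rewrite mdistxx; lra.
Qed.

Theorem theorem4p3 (R : realType) (T : completeMetricType R)
    (hT : metric_tree T) (xstar : T)
    (n : nat) (x : 'I_n -> T) (alpha : 'I_n -> R)
    (alpha_gt0 : forall k, 0 < alpha k)
    (alpha_sum1 : \sum_(k < n) alpha k = 1)
    (x0 : T) :
  projections (canonical_embedding xstar)
    (\sum_(k < n) alpha k *: canonical_embedding xstar (x k)) x0
  <->
  (forall y : T, mdist x0 y <= \sum_(k < n) alpha k * mdist (x k) y).
Proof.
have alpha_ge0 k := ltW (alpha_gt0 k).
have distE := dist_convex_canonical_embedding xstar x _ alpha_ge0 alpha_sum1.
split=> [[pi [_ pi_id pi_lip] pi_x0] y|x0_le].
  rewrite -distE -(canonical_embedding_isometry xstar) -pi_x0.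
  have := pi_lip (\sum_(k < n) alpha k *: canonical_embedding xstar (x k),
    canonical_embedding xstar y) (conj I I).
  by rewrite /= mul1r (pi_id (canonical_embedding xstar y))// inE; exists y.
have [p [p_id p_lip p_w]] := canonical_embedding_retraction hT xstar x0.
exists (canonical_embedding xstar \o p) => /=; last first.
  by rewrite p_w// => y; rewrite distE.
split=> [|_ /set_mem[y _ <-]|[f g] _ /=]; last 2 first.
- by rewrite /= p_id.
- by rewrite mul1r canonical_embedding_isometry p_lip.
apply/seteqP; split=> _ [y _ <-] /=; first by exists (p y).
by exists (canonical_embedding xstar y) => //; rewrite /= p_id.
Qed.
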